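(* Let $G=(N,E)$ be any finite undirected simple graph with $N=\{1,\dots,n\}$. For any $k\in\{2,\ldots,n-1\}$, $$\alpha^{\rm sus}\left(G,\mathrm{UR}(k)\right) = \alpha^{\rm sus}\left(G,\mathrm{UR}(1)\right).$$
   Context: Graphical coordination game $(G,\alpha)$, $\alpha\in\mathbb{R}$: agents $N$ each choose an action in $\{x,y\}$; joint action space $\mathcal{A}=\{x,y\}^n$. The two-player payoff is $u(x,x)=1+\alpha$, $u(y,y)=1$, $u(x,y)=u(y,x)=0$. With $\mathcal{N}_i=\{j:\{i,j\}\in E\}$, $U_i(a)=\sum_{j\in\mathcal{N}_i}u(a_i,a_j)$. Write $\vec{x}=(x,\dots,x)$, $\vec{y}=(y,\dots,y)$. Adversarial influence: for an influence set $S\subseteq N$, the influenced utility is $\tilde U_i(a,S)=U_i(a)+1$ if $i\in S$ and $a_i=y$, and $\tilde U_i(a,S)=U_i(a)$ otherwise. A uniformly random adversary with capability $k$ (type $\mathrm{UR}(k)$) draws at each time $t$ the influence set $S(t)$ uniformly at random from $\{S\subseteq N:|S|=k\}$, independently across time (and of the choice of updating agent). Log-linear learning with parameter $\beta>0$: at each time $t=0,1,2,\dots$ an agent $i$ is selected uniformly at random from $N$; all other agents keep their actions, and agent $i$ chooses its next action to be $x$ with probability $$\frac{e^{\beta \tilde U_i((x,a_{-i}),S(t))}}{e^{\beta \tilde U_i((x,a_{-i}),S(t))}+e^{\beta \tilde U_i((y,a_{-i}),S(t))}}$$ and $y$ otherwise, where $a=a(t)$ is the current joint action. This defines an irreducible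 aperiodic Markov chain on $\mathcal{A}$ with unique stationary distribution $\pi_\beta$; let $\pi=\lim_{\beta\to\infty}\pi_\beta$. A joint action $a$ is strictly stochastically stable if $\pi(a)=1$. Susceptibility: $(G,\alpha)$ is susceptible to $\mathrm{UR}(k)$ if $\vec{y}$ is strictly stochastically stable under the $\mathrm{UR}(k)$ adversary; $\alpha^{\rm sus}(G,\mathrm{UR}(k))=\sup\{\alpha\in\mathbb{R}: (G,\alpha)\text{ is susceptible to }\mathrm{UR}(k)\}$, a supremum in the extended reals ($\sup\emptyset=-\infty$). *)

(* Defs.v *)
From mathcomp Require Import all_boot all_order all_algebra.
From mathcomp Require Import all_classical all_reals all_analysis.

Set Implicit Arguments.
Unset Strict Implicit.
Unset Printing Implicit Defensive.

Import Order.TTheory GRing.Theory Num.Theory numFieldNormedType.Exports.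

Local Open Scope ring_scope.
Local Open Scope classical_set_scope.

Record simple_graph (n : nat) := SimpleGraph {
  adj : rel 'I_n;
  adj_sym : symmetric adj;
  adj_irr : irreflexive adj }.

Definition action : finType := bool.
Definition act_x : action := true.
Definition act_y : action := false.

Definition profile (n : nat) : finType := {ffun 'I_n -> action}.

Definition all_y (n : nat) : profile n := [ffun=> act_y].

(* (c, a_{-i}) *)
Definition deviate (n : nat) (a : profile n) (i : 'I_n) (c : action) :
    profile n :=
  [ffun j => if j == i then c else a j].

Section Game.
Variables (R : realType) (n : nat) (G : simple_graph n) (alpha : R).

Definition payoff (c d : action) : R :=
  if c == d then (if c == act_x then 1 + alpha else 1) else 0.

Definition utility (a : profile n) (i : 'I_n) : R :=
  \sum_(j | adj G i j) payoff (a i) (a j).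

Definition influenced_utility (a : profile n) (S : {set 'I_n}) (i : 'I_n) : R :=
  if (i \in S) && (a i == act_y) then utility a i + 1 else utility a i.

Definition prob_x (beta : R) (a : profile n) (S : {set 'I_n}) (i : 'I_n) : R :=
  expR (beta * influenced_utility (deviate a i act_x) S i) /
  (expR (beta * influenced_utility (deviate a i act_x) S i) +
   expR (beta * influenced_utility (deviate a i act_y) S i)).

Definition choice_prob (beta : R) (a : profile n) (S : {set 'I_n}) (i : 'I_n)
    (c : action) : R :=
  if c == act_x then prob_x beta a S i else 1 - prob_x beta a S i.

(* An adversary drawing its influence sets independently across time is given
   by the probability mass function of a single draw. *)
Definition adversary := {set 'I_n} -> R.

Definition UR (k : nat) : adversary := fun S =>
  if #|S| == k then #|[set T : {set 'I_n} | #|T| == k]%SET|%:R^-1 else 0.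

(* One-step transition probability from a to b: the updating agent i is uniform
   and independent of the influence set S. *)
Definition transition (adv : adversary) (beta : R) (a b : profile n) : R :=
  \sum_(i : 'I_n) n%:R^-1 *
    \sum_(S : {set 'I_n}) adv S *
      \sum_(c : action) choice_prob beta a S i c * (b == deviate a i c)%:R.

End Game.

Arguments UR : clear implicits.

Definition stationary (R : realType) (T : finType) (P : T -> T -> R)
    (mu : {ffun T -> R}) : Prop :=
  [/\ forall a, 0 <= mu a, \sum_a mu a = 1
    & forall b, \sum_a mu a * P a b = mu b].

(* The stationary distribution of P, meaningful when there is exactly one, as
   for the irreducible chains considered here; the zero function is the junk
   value in the absence of a stationary distribution. *)
Definition stationary_distribution (R : realType) (T : finType)
    (P : T -> T -> R) : {ffun T -> R} :=
  xget [ffun=> 0] [set mu | stationary P mu].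

Definition strictly_stochastically_stable (R : realType) (n : nat)
    (G : simple_graph n) (alpha : R) (adv : adversary R n) (a : profile n) :
    Prop :=
  stationary_distribution (transition G alpha adv beta) a
    @[beta --> +oo] --> (1 : R).

Definition susceptible (R : realType) (n : nat) (G : simple_graph n)
    (alpha : R) (adv : adversary R n) : Prop :=
  strictly_stochastically_stable G alpha adv (all_y n).

Definition alpha_sus (R : realType) (n : nat) (G : simple_graph n)
    (adv : adversary R n) : \bar R :=
  ereal_sup [set alpha%:E | alpha in [set alpha : R | susceptible G alpha adv]].

(* Main.v *)
(** The k-dependence of the chain is only through the probability, bounded away
    from 0 and 1 when 0 < k < n, that the updating agent is influenced.  Hence
    the transition probabilities under UR(k) and UR(1) agree up to a factor that
    does not depend on beta.  Eliminating the states one by one shows that the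
    ratios of the stationary weights then also agree up to a factor independent
    of beta, so that the mass outside of all_y vanishes for both or for none. *)
Require Import Defs.
From mathcomp Require Import all_boot all_order all_algebra.
From mathcomp Require Import all_classical all_reals all_analysis.
From mathcomp Require Import ring.

Set Implicit Arguments.
Unset Strict Implicit.
Unset Printing Implicit Defensive.

Import Order.TTheory GRing.Theory Num.Theory numFieldNormedType.Exports.

Local Open Scope ring_scope.

(** * State elimination in positive kernels *)

Section Elimination.
Variables (R : realFieldType) (T : finType).
Implicit Types (q : T -> T -> R) (mu : T -> R) (A : {set T}) (C : R).

(** Global balance, inflow equal to outflow, for rates whose rows need not sum to 1; this form
    survives the removal of a state. *)
Definition balanced A q mu :=
  forall b, b \in A ->
    \sum_(a in A) mu a * q a b = mu b * \sum_(c in A) q b c.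

Definition dominated C q1 q2 := forall a b, q1 a b <= C * q2 a b.

(** The rates of the chain watched only outside [s]: a visit to [s] becomes a direct jump, routed to
    [b] with the conditional probability of exiting from [s] to [b]. *)
Definition eliminate A (s : T) q : T -> T -> R := fun a b =>
  q a b + q a s * q s b / \sum_(c in A :\ s) q s c.

Lemma sum_setD1_gt0 A (s a : T) q : (forall a b, 0 < q a b) ->
  a \in A -> a != s -> 0 < \sum_(c in A :\ s) q s c.
Proof.
move=> q0 aA as_; rewrite (bigD1 a) ?in_setD1 ?as_//=.
by rewrite ltr_wpDr// sumr_ge0// => c _; exact: ltW.
Qed.

Lemma eliminate_gt0 A (s : T) q : (forall a b, 0 < q a b) ->
  forall a b, 0 < eliminate A s q a b.
Proof.
move=> q0 a b; rewrite ltr_wpDr//.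
rewrite mulr_ge0 ?invr_ge0 ?mulr_ge0 ?(ltW (q0 _ _))//.
by rewrite sumr_ge0// => c _; exact: ltW.
Qed.

(** Balance at [s] expresses [mu s] through the inflow into [s]; substituting it into the balance at
    [b] gives the censored equations. *)
Lemma balanced_eliminate A (s : T) q mu :
  s \in A -> \sum_(c in A :\ s) q s c != 0 ->
  balanced A q mu -> balanced (A :\ s) (eliminate A s q) mu.
Proof.
move=> sA; set o := \sum_(c in A :\ s) q s c => o0 bal b bAs.
have bA : b \in A by move: bAs; rewrite in_setD1 => /andP[].
have sum_s (F : T -> R) : \sum_(a in A) F a = F s + \sum_(a in A :\ s) F a.
  by rewrite (big_setD1 s).
have inflow : \sum_(a in A :\ s) mu a * q a s = mu s * o.
  move: (bal _ sA); rewrite !sum_s -/o mulrDr => h.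
  exact: (addrI (mu s * q s s)).
transitivity (\sum_(a in A) mu a * q a b).
  rewrite sum_s /eliminate -/o.
  under eq_bigr do rewrite mulrDr.
  rewrite big_split/= addrC; congr (_ + _).
  transitivity (\sum_(a in A :\ s) mu a * q a s * (q s b / o)).
    by apply: eq_bigr => a _; rewrite !mulrA.
  by rewrite -mulr_suml inflow; field.
(* The outflow of [b] is unchanged, since the rate [q b s] is redistributed in full. *)
rewrite bal//; congr (_ * _).
rewrite sum_s /eliminate -/o big_split/= addrC; congr (_ + _).
transitivity (\sum_(c in A :\ s) q s c * (q b s / o)).
  by rewrite -mulr_suml -/o; field.
by apply: eq_bigr => c _; field.
Qed.

(** A detour through [s] has two rates in the numerator and a total rate in the denominator, each
    costing one factor [C]; the denominator uses the reverse domination. *)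
Lemma dominated_eliminate A (s a : T) q1 q2 C :
  a \in A -> a != s -> 1 <= C ->
  (forall a b, 0 < q1 a b) -> (forall a b, 0 < q2 a b) ->
  dominated C q1 q2 -> dominated C q2 q1 ->
  dominated (C ^+ 3) (eliminate A s q1) (eliminate A s q2).
Proof.
move=> aA as_ C1 p1 p2 d12 d21 x y; rewrite /eliminate.
have o1 := sum_setD1_gt0 p1 aA as_; have o2 := sum_setD1_gt0 p2 aA as_.
set O1 := \sum_(c in _) q1 s c in o1 *; set O2 := \sum_(c in _) q2 s c in o2 *.
have C0 : 0 < C by exact: lt_le_trans C1.
have O21 : O2 <= C * O1 by rewrite mulr_sumr ler_sum.
rewrite mulrDr lerD//.
  apply: le_trans (d12 x y) _; rewrite ler_pM2r//.
  by rewrite -[leLHS]expr1 ler_weXn2l.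
have -> : C ^+ 3 * (q2 x s * q2 s y / O2) =
    (C * q2 x s) * (C * q2 s y) * (C / O2).
  by rewrite !exprS expr0; ring.
rewrite ler_pM ?mulr_ge0 ?invr_ge0 ?(ltW (p1 _ _)) ?(ltW o1)//.
  by rewrite ler_pM ?(ltW (p1 _ _)).
by rewrite ler_pdivlMr// mulrC ler_pdivrMr.
Qed.

(** All states but [a] and [b] are eliminated in turn, each elimination cubing the constant; the
    last two states cost its square. The cross-multiplied form avoids dividing by weights that may
    vanish. *)
Lemma balanced_ratio m A q1 q2 mu1 mu2 C : #|A| = m -> 1 <= C ->
  (forall a b, 0 < q1 a b) -> (forall a b, 0 < q2 a b) ->
  (forall a, 0 <= mu1 a) -> (forall a, 0 <= mu2 a) ->
  dominated C q1 q2 -> dominated C q2 q1 ->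
  balanced A q1 mu1 -> balanced A q2 mu2 ->
  {in A &, forall a b,
    mu1 a * mu2 b <= C ^+ (2 * 3 ^ m) * (mu2 a * mu1 b)}.
Proof.
elim: m A q1 q2 C => [|m IH] A q1 q2 C Am C1 p1 p2 m1 m2 d12 d21 b1 b2 a b.
  by rewrite (cards0_eq Am) inE.
move=> aA bA.
have [->|ab] := eqVneq a b.
  rewrite [mu2 b * _]mulrC ler_peMl ?mulr_ge0//.
  by rewrite exprn_ege1.
have [/exists_inP[s sA /andP[sa sb]]|none] :=
    boolP [exists s in A, (s != a) && (s != b)].
  have as_ : a != s by rewrite eq_sym.
  have [out1 out2] := (sum_setD1_gt0 p1 aA as_, sum_setD1_gt0 p2 aA as_).
  have -> : (2 * 3 ^ m.+1 = 3 * (2 * 3 ^ m))%N by rewrite expnS mulnCA.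
  rewrite exprM.
  apply: (IH (A :\ s) (eliminate A s q1) (eliminate A s q2)) => //.
  - by move: (cardsD1 s A); rewrite sA Am add1n => -[].
  - exact: exprn_ege1.
  - exact: eliminate_gt0.
  - exact: eliminate_gt0.
  - exact: dominated_eliminate aA _ _ _ _ _ _.
  - exact: dominated_eliminate aA _ _ _ _ _ _.
  - by apply: balanced_eliminate => //; rewrite gt_eqF.
  - by apply: balanced_eliminate => //; rewrite gt_eqF.
  - by rewrite in_setD1 as_.
  - by rewrite in_setD1 eq_sym sb.
have AE : A = [set a; b]%SET.
  apply/setP => s; rewrite in_set2; apply/idP/idP => [sA|/orP[]/eqP->//].
  apply: contraNT none; rewrite negb_or => h.
  by apply/exists_inP; exists s.
(* On two states global balance is detailed balance, once the self-loop term cancels. *)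
have detailed q mu : balanced A q mu -> mu a * q a b = mu b * q b a.
  move=> /(_ _ bA); rewrite AE !big_setU1 ?finset.in_set1//= !big_set1 mulrDr.
  by move=> h; apply: (addIr (mu b * q b b)).
have [e1 e2] := (detailed _ _ b1, detailed _ _ b2).
have C0 : 0 < C by exact: lt_le_trans C1.
have := p1 a b; have := p2 b a => q2ba q1ab.
(* After this multiplication, detailed balance in both chains turns the claim into a comparison of
   rates only. *)
rewrite -(ler_pM2r (mulr_gt0 q1ab q2ba)).
have -> : mu1 a * mu2 b * (q1 a b * q2 b a) =
    (mu2 a * mu1 b) * (q1 b a * q2 a b).
  by rewrite mulrACA e1 -e2; ring.
have -> : C ^+ (2 * 3 ^ m.+1) * (mu2 a * mu1 b) * (q1 a b * q2 b a) =
    (mu2 a * mu1 b) * (C ^+ (2 * 3 ^ m.+1) * (q1 a b * q2 b a)) by ring.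
rewrite ler_wpM2l ?mulr_ge0//.
apply: (@le_trans _ _ (C ^+ 2 * (q1 a b * q2 b a))); last first.
  rewrite ler_pM2r ?mulr_gt0// ler_weXn2l//.
  by rewrite leq_pmulr// expn_gt0.
have -> : C ^+ 2 * (q1 a b * q2 b a) = (C * q2 b a) * (C * q1 a b) by ring.
by rewrite ler_pM ?(ltW (p1 _ _)) ?(ltW (p2 _ _)).
Qed.

End Elimination.

(** * Stationary distributions of finite stochastic kernels: comparison and existence *)

Section Stochastic.
Variables (R : realType) (T : finType).
Implicit Types (P Q : T -> T -> R) (mu : {ffun T -> R}).

(** Powers supply the strictly positive kernels that elimination requires: one step of learning
    changes at most one coordinate, so the transition kernel itself can have zero entries. *)
Fixpoint kernel_pow P m : T -> T -> R :=
  if m is m'.+1 then fun a b => \sum_c P a c * kernel_pow P m' c b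
  else fun a b => (a == b)%:R.

Lemma kernel_pow_ge0 P m : (forall a b, 0 <= P a b) ->
  forall a b, 0 <= kernel_pow P m a b.
Proof.
move=> P0; elim: m => [|m IH] a b //=.
by rewrite sumr_ge0// => c _; rewrite mulr_ge0.
Qed.

Lemma kernel_powS_gt0 P m a b c : (forall a b, 0 <= P a b) ->
  0 < P a c -> 0 < kernel_pow P m c b -> 0 < kernel_pow P m.+1 a b.
Proof.
move=> P0 ac cb /=; rewrite (bigD1 c)//= ltr_wpDr ?mulr_gt0//.
by rewrite sumr_ge0// => d _; rewrite mulr_ge0 ?kernel_pow_ge0.
Qed.

Lemma dominated_kernel_pow P Q C m :
  (forall a b, 0 <= P a b) -> (forall a b, 0 <= Q a b) -> 0 <= C ->
  dominated C P Q -> dominated (C ^+ m) (kernel_pow P m) (kernel_pow Q m).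
Proof.
move=> P0 Q0 C0 PQ; elim: m => [|m IH] a b /=; first by rewrite mul1r.
rewrite mulr_sumr ler_sum// => c _.
by rewrite exprS mulrACA ler_pM// kernel_pow_ge0.
Qed.

Lemma kernel_pow_sum1 P m : (forall a, \sum_b P a b = 1) ->
  forall a, \sum_b kernel_pow P m a b = 1.
Proof.
move=> P1; elim: m => [|m IH] a /=.
  rewrite (bigD1 a)//= eqxx big1 ?addr0// => b /negbTE ba.
  by rewrite eq_sym ba.
rewrite exchange_big/= -(P1 a); apply: eq_bigr => c _.
by rewrite -mulr_sumr IH mulr1.
Qed.

Lemma kernel_pow_invariant P mu m : (forall b, \sum_a mu a * P a b = mu b) ->
  forall b, \sum_a mu a * kernel_pow P m a b = mu b.
Proof.
move=> Pmu; elim: m => [|m IH] b /=.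
  rewrite (bigD1 b)//= eqxx mulr1 big1 ?addr0// => a /negbTE ->.
  by rewrite mulr0.
rewrite -[RHS]IH; under eq_bigr do rewrite mulr_sumr.
rewrite exchange_big/=; apply: eq_bigr => c _.
by rewrite -[in RHS]Pmu mulr_suml; apply: eq_bigr => a _; rewrite mulrA.
Qed.

(** Both distributions remain stationary for the positive [m]-th powers, which dominate each other
    with constant [C ^+ m], so [balanced_ratio] applies to the whole state space. *)
Lemma stationary_dominated P Q mu nu C m : 1 <= C ->
  (forall a b, 0 <= P a b) -> (forall a b, 0 <= Q a b) ->
  (forall a, \sum_b P a b = 1) -> (forall a, \sum_b Q a b = 1) ->
  (forall a b, 0 < kernel_pow P m a b) ->
  (forall a b, 0 < kernel_pow Q m a b) ->
  dominated C P Q -> dominated C Q P ->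
  stationary P mu -> stationary Q nu ->
  forall a, mu a <= (C ^+ m) ^+ (2 * 3 ^ #|T|) * nu a.
Proof.
move=> C1 P0 Q0 P1 Q1 Pm Qm PQ QP [mu0 mu1 Pmu] [nu0 nu1 Qnu] a.
have C0 : 0 <= C by exact: le_trans C1.
have balT K lam : (forall a, \sum_b K a b = 1) ->
    (forall b, \sum_a lam a * K a b = lam b) -> balanced [set: T] K lam.
  move=> K1 Klam b _.
  rewrite (eq_bigl predT) => [|c]; last by rewrite inE.
  rewrite Klam (eq_bigl predT) => [|c]; last by rewrite inE.
  by rewrite K1 mulr1.
(* Inserting the total masses of [nu] on the left and of [mu] on the right leaves a cross-multiplied
   comparison for each [b]. *)
rewrite -[leLHS]mulr1 -nu1 -[nu a]mulr1 -mu1 mulrA !mulr_sumr ler_sum// => b _.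
rewrite -mulrA.
apply: (@balanced_ratio _ _ _ [set: T] (kernel_pow P m) (kernel_pow Q m)).
- by rewrite cardsT.
- exact: exprn_ege1.
- by [].
- by [].
- by [].
- by [].
- exact: dominated_kernel_pow.
- exact: dominated_kernel_pow.
- apply: balT; [exact: kernel_pow_sum1|exact: kernel_pow_invariant].
- apply: balT; [exact: kernel_pow_sum1|exact: kernel_pow_invariant].
- by rewrite inE.
- by rewrite inE.
Qed.

(** Row sums 1 put the constant column in the right kernel of [M - 1%:M]. It is nonzero because [t]
    inhabits [T], so the square matrix is singular and has a nonzero left kernel too. *)
Lemma left_fixed_vector P (t : T) : (forall a, \sum_b P a b = 1) ->
  exists2 v : T -> R, (exists a, v a != 0) & forall b, \sum_a v a * P a b = v b.
Proof.
move=> P1; pose M : 'M[R]_#|T| := \matrix_(i, j) P (enum_val i) (enum_val j).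
have MN1 : (M - 1%:M) *m const_mx 1 = 0 :> 'cV_#|T|.
  apply/colP => i; rewrite mulmxBl mul1mx !mxE -[X in _ - X](P1 (enum_val i)).
  rewrite (reindex _ (onW_bij _ (@enum_val_bij T)))/=.
  by rewrite -sumrB big1// => j _; rewrite !mxE mulr1 subrr.
have : \rank (kermx (M - 1%:M)) != 0%N.
  rewrite mxrank_ker subn_eq0 -ltnNge ltn_neqAle rank_leq_row andbT.
  apply/negP => Mfree.
  have Mu : M - 1%:M \in unitmx by rewrite -row_free_unit.
  have := congr1 (mulmx (invmx (M - 1%:M))) MN1.
  rewrite mulmxA mulVmx// mul1mx mulmx0 => /colP/(_ (enum_rank t)).
  by rewrite !mxE => /eqP; rewrite oner_eq0.
rewrite mxrank_eq0 => /rowV0Pn[w /sub_kermxP wM wn0].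
exists (fun a => w 0 (enum_rank a)).
  have /existsP[i wi] : [exists i, w 0 i != 0].
    apply: contraR wn0 => /existsPn w0; apply/eqP/rowP => i.
    by rewrite mxE; apply/eqP; have := w0 i; rewrite negbK.
  by exists (enum_val i); rewrite enum_valK.
move=> b; move/rowP: wM => /(_ (enum_rank b)).
rewrite mulmxBr mulmx1 !mxE => /eqP; rewrite subr_eq0 => /eqP <-.
rewrite (reindex _ (onW_bij _ (@enum_val_bij T)))/=.
by apply: eq_bigr => i _; rewrite mxE enum_valK enum_rankK.
Qed.

(** The absolute value of a left fixed vector is again fixed; normalising it gives a
    distribution. *)
Lemma stationary_ex P (t : T) : (forall a b, 0 <= P a b) ->
  (forall a, \sum_b P a b = 1) -> exists mu, stationary P mu.
Proof.
move=> P0 P1; have [v [a0 va0] vP] := left_fixed_vector t P1.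
pose s := \sum_a `|v a|.
have s0 : 0 < s.
  rewrite /s (bigD1 a0)//= ltr_wpDr ?normr_gt0//.
  by rewrite sumr_ge0.
have absle b : `|v b| <= \sum_a `|v a| * P a b.
  rewrite -vP (le_trans (ler_norm_sum _ _ _))// ler_sum// => a _.
  by rewrite normrM [`|P a b|]ger0_norm.
(* |v| <= |v| P pointwise and both have the same total mass. *)
have abs_eq b : \sum_a `|v a| * P a b = `|v b|.
  apply/eqP; rewrite -subr_eq0; apply/eqP.
  apply: (@psumr_eq0P _ _ predT
    (fun b => \sum_a `|v a| * P a b - `|v b|)) => //.
  - by move=> c _; rewrite subr_ge0.
  - rewrite sumrB exchange_big/=; apply/eqP; rewrite subr_eq0; apply/eqP.
    by apply: eq_bigr => a _; rewrite -mulr_sumr P1 mulr1.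
exists [ffun a => `|v a| / s]; split.
- by move=> a; rewrite ffunE divr_ge0// ltW.
- under eq_bigr do rewrite ffunE.
  by rewrite -mulr_suml divff ?gt_eqF.
- move=> b; rewrite ffunE -abs_eq mulr_suml.
  by apply: eq_bigr => a _; rewrite ffunE mulrAC.
Qed.

(** Existence rules out the default value of [xget]. *)
Lemma stationary_distributionP P (t : T) : (forall a b, 0 <= P a b) ->
  (forall a, \sum_b P a b = 1) -> stationary P (stationary_distribution P).
Proof.
move=> P0 P1; have [mu Pmu] := stationary_ex t P0 P1.
by rewrite /stationary_distribution; case: xgetP => [nu _ //|/(_ mu)].
Qed.

End Stochastic.

(** * Uniformly random influence sets and the learning chain *)

Section UniformAdversary.
Variables (R : realType) (n : nat).
Implicit Types (k : nat) (i : 'I_n) (S : {set 'I_n}).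

Lemma UR_ge0 k S : 0 <= UR R n k S.
Proof. by rewrite /UR; case: ifP => // _; rewrite invr_ge0. Qed.

Lemma UR_sum1 k : (k <= n)%N -> \sum_S UR R n k S = 1.
Proof.
move=> kn; rewrite /UR -big_mkcond/= sumr_const.
rewrite (eq_card (B := [set S : {set 'I_n} | #|S| == k]))//; last first.
  by move=> S; rewrite inE.
rewrite -[LHS]mulr_natl divff// pnatr_eq0 card_draws card_ord.
by rewrite -lt0n bin_gt0.
Qed.

Lemma kset_ex k i (c : bool) : (0 < k < n)%N ->
  exists2 S : {set 'I_n}, #|S| == k & (i \in S) = c.
Proof.
move=> /andP[k0 kn].
have sub (A : {set 'I_n}) m : (m <= #|A|)%N ->
    exists2 S : {set 'I_n}, S \subset A & #|S| = m.
  move=> mA; have : (0 < #|[set S : {set 'I_n} | S \subset A & #|S| == m]|)%N.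
    by rewrite cards_draws bin_gt0.
  by move=> /card_gt0P[S]; rewrite inE => /andP[SA /eqP Sm]; exists S.
have Ai : #|~: [set i]| = n.-1 by rewrite cardsC1 card_ord.
(* Here [c] counts as 0 or 1, leaving room to add [i] exactly when it must belong to the set. *)
have [|S SA Sk] := sub (~: [set i]) (k - c)%N.
  rewrite Ai; case: n kn i sub Ai => // p kp _ _ _ /=.
  by rewrite (leq_trans (leq_subr _ _)).
have iS : i \notin S.
  by apply/negP => /(fintype.subsetP SA); rewrite !inE eqxx.
case: c Sk => Sk.
  exists (i |: S); last by rewrite setU11.
  by rewrite cardsU1 iS Sk subnKC.
by exists S; [rewrite Sk subn0|exact: negbTE].
Qed.

(** For [k <= n] this is k/n when [c] is true and 1 - k/n otherwise; the proof works with crude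
    bounds on it. *)
Definition influence_prob k i (c : bool) : R :=
  \sum_(S : {set 'I_n} | (i \in S) == c) UR R n k S.

Lemma influence_prob_le1 k i c : (k <= n)%N -> influence_prob k i c <= 1.
Proof.
move=> kn; rewrite -(UR_sum1 kn) /influence_prob big_mkcond ler_sum// => S _.
by case: ifP => // _; exact: UR_ge0.
Qed.

(** A single suitable [k]-set already has mass at least [(2 ^ n)%:R^-1], as there are at most
    [2 ^ n] sets to draw from. *)
Lemma influence_prob_ge k i c : (0 < k < n)%N ->
  (2 ^ n)%:R^-1 <= influence_prob k i c.
Proof.
move=> kn; have [S Sk iS] := kset_ex i c kn.
rewrite /influence_prob (bigD1 S) ?iS//= -[leLHS]addr0 lerD//; last first.
  by rewrite sumr_ge0// => U _; exact: UR_ge0.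
rewrite /UR Sk lef_pV2 ?posrE ?ltr0n ?expn_gt0//; last first.
  by apply/card_gt0P; exists S; rewrite inE.
rewrite ler_nat (leq_trans (max_card _))//.
by rewrite -cardsT -powersetT card_powerset cardsT card_ord.
Qed.

Lemma influence_prob_dominated k1 k2 i c : (k1 <= n)%N -> (0 < k2 < n)%N ->
  influence_prob k1 i c <= (2 ^ n)%:R * influence_prob k2 i c.
Proof.
move=> h1 h2; apply: le_trans (influence_prob_le1 _ _ h1) _.
rewrite -ler_pdivrMl ?ltr0n ?expn_gt0// mulr1.
exact: influence_prob_ge.
Qed.

Lemma UR_expect k i (g : bool -> R) :
  \sum_(S : {set 'I_n}) UR R n k S * g (i \in S) =
  \sum_c influence_prob k i c * g c.
Proof.
rewrite (partition_big (fun S : {set 'I_n} => i \in S) predT)//=.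
apply: eq_bigr => c _; rewrite mulr_suml.
by apply: eq_bigr => S /eqP ->.
Qed.

Variables (G : simple_graph n) (alpha beta : R).

Lemma prob_x_itv a S i : 0 < prob_x G alpha beta a S i < 1.
Proof.
rewrite /prob_x; set u := expR _; set v := expR _.
have [u0 v0] : 0 < u /\ 0 < v by split; exact: expR_gt0.
by rewrite divr_gt0 ?addr_gt0//= ltr_pdivrMr ?addr_gt0// mul1r ltrDl.
Qed.

Lemma choice_prob_gt0 a S i c : 0 < choice_prob G alpha beta a S i c.
Proof.
have /andP[h0 h1] := prob_x_itv a S i.
by rewrite /choice_prob; case: ifP => // _; rewrite subr_gt0.
Qed.

Lemma choice_prob_sum1 a S i : \sum_c choice_prob G alpha beta a S i c = 1.
Proof. by rewrite big_bool /choice_prob /= subrKC. Qed.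

(* Only the membership of i in S matters for the choice of i. *)
Definition move_prob (a b : profile n) i (infl : bool) : R :=
  \sum_(c : action)
    choice_prob G alpha beta a (if infl then [set i] else finset.set0) i c *
    (b == deviate a i c)%:R.

Lemma move_prob_ge0 a b i infl : 0 <= move_prob a b i infl.
Proof.
by rewrite sumr_ge0// => c _; rewrite mulr_ge0// ltW// choice_prob_gt0.
Qed.

Lemma move_prob_gt0 a i c infl : 0 < move_prob a (deviate a i c) i infl.
Proof.
rewrite /move_prob (bigD1 c)//= eqxx mulr1 ltr_wpDr ?choice_prob_gt0//.
by rewrite sumr_ge0// => d _; rewrite mulr_ge0// ltW// choice_prob_gt0.
Qed.

Lemma choice_prob_influence a S i c : choice_prob G alpha beta a S i c =
  choice_prob G alpha beta a (if i \in S then [set i] else finset.set0) i c.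
Proof.
rewrite /choice_prob /prob_x /influenced_utility.
by case: (i \in S); rewrite ?finset.in_set1 ?eqxx ?finset.in_set0.
Qed.

(** Separates the parameters: [k] enters only through [influence_prob], and [alpha] and [beta] only
    through [move_prob]. *)
Lemma transition_influence k a b : transition G alpha (UR R n k) beta a b =
  \sum_i n%:R^-1 * \sum_c influence_prob k i c * move_prob a b i c.
Proof.
apply: eq_bigr => i _; congr (_ * _).
rewrite -UR_expect; apply: eq_bigr => S _; congr (_ * _).
by apply: eq_bigr => c _; rewrite choice_prob_influence.
Qed.

Lemma influence_prob_gt0 k i c : (0 < k < n)%N -> 0 < influence_prob k i c.
Proof.
move=> /(influence_prob_ge i c); apply: lt_le_trans.
by rewrite invr_gt0 ltr0n expn_gt0.
Qed.

Lemma influence_prob_ge0 k i c : 0 <= influence_prob k i c.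
Proof. by rewrite sumr_ge0// => S _; exact: UR_ge0. Qed.

Lemma transition_ge0 k a b : 0 <= transition G alpha (UR R n k) beta a b.
Proof.
rewrite transition_influence sumr_ge0// => i _; rewrite mulr_ge0 ?invr_ge0//.
rewrite sumr_ge0// => c _.
by rewrite mulr_ge0 ?influence_prob_ge0 ?move_prob_ge0.
Qed.

Lemma transition_sum1 k a : (k <= n)%N -> (0 < n)%N ->
  \sum_b transition G alpha (UR R n k) beta a b = 1.
Proof.
move=> kn n0; rewrite exchange_big/=.
under eq_bigr => i _.
  rewrite -mulr_sumr exchange_big/=.
  under eq_bigr => S _.
    rewrite -mulr_sumr exchange_big/=.
    under eq_bigr => c _.
      rewrite -mulr_sumr (bigD1 (deviate a i c))//= eqxx.
      rewrite big1 ?addr0 ?mulr1; last by move=> b /negbTE ->.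
      over.
    rewrite choice_prob_sum1 mulr1; over.
  rewrite UR_sum1// mulr1; over.
by rewrite sumr_const card_ord -[LHS]mulr_natl divff// pnatr_eq0 -lt0n.
Qed.

(** The comparison of influence probabilities carries over term by term, with a constant free of
    [beta]. *)
Lemma transition_dominated k1 k2 : (k1 <= n)%N -> (0 < k2 < n)%N ->
  dominated (2 ^ n)%:R (transition G alpha (UR R n k1) beta)
    (transition G alpha (UR R n k2) beta).
Proof.
move=> h1 h2 a b; rewrite !transition_influence mulr_sumr ler_sum// => i _.
rewrite mulrCA ler_wpM2l ?invr_ge0// mulr_sumr ler_sum// => c _.
by rewrite mulrA ler_wpM2r ?move_prob_ge0 ?influence_prob_dominated.
Qed.

Lemma transition_deviate_gt0 k a i c : (0 < k < n)%N ->
  0 < transition G alpha (UR R n k) beta a (deviate a i c).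
Proof.
move=> kn; have n0 : (0 < n)%N by case/andP: kn => _; exact: leq_ltn_trans.
rewrite transition_influence (bigD1 i)//= ltr_wpDr//.
  rewrite sumr_ge0// => j _; rewrite mulr_ge0 ?invr_ge0//.
  rewrite sumr_ge0// => d _.
  by rewrite mulr_ge0 ?influence_prob_ge0 ?move_prob_ge0.
rewrite mulr_gt0 ?invr_gt0 ?ltr0n// big_bool.
by rewrite addr_gt0// mulr_gt0 ?influence_prob_gt0 ?move_prob_gt0.
Qed.

(** Each step can correct one disagreeing agent. Bounding the number of disagreements by [m],
    instead of fixing it, lets one power serve all pairs of profiles. *)
Lemma transition_pow_gt0 k m (a b : profile n) : (0 < k < n)%N ->
  (#|[set i | a i != b i]| <= m)%N ->
  0 < kernel_pow (transition G alpha (UR R n k) beta) m a b.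
Proof.
move=> kn; elim: m a => [|m IH] a.
  rewrite leqn0 cards_eq0 => /eqP ab0 /=.
  suff -> : a = b by rewrite eqxx.
  apply/ffunP => i; apply/eqP; apply: contraT => abi.
  by have := finset.in_set0 i; rewrite -ab0 inE abi.
move=> abm; have n0 : (0 < n)%N by case/andP: kn => _; exact: leq_ltn_trans.
(* If a = b, the step may be wasted at any agent. *)
have [i abi] : exists i, a = b \/ a i != b i.
  have [->|ab] := eqVneq a b; first by exists (Ordinal n0); left.
  have /existsP[i abi] : [exists i, a i != b i].
    apply: contraR ab => /existsPn ab; apply/eqP/ffunP => i.
    by apply/eqP; have := ab i; rewrite negbK.
  by exists i; right.
apply: (@kernel_powS_gt0 _ _ _ _ _ _ (deviate a i (b i))).
- by move=> ? ?; exact: transition_ge0.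
- exact: transition_deviate_gt0.
apply: IH; have dev : [set j | deviate a i (b i) j != b j] =
    ([set j | a j != b j] :\ i)%SET.
  apply/setP => j; rewrite !inE ffunE.
  by have [->|//] := eqVneq j i; rewrite eqxx.
rewrite dev; case: abi => [ab|abi].
  rewrite ab (_ : [set j | b j != b j]%SET = finset.set0) ?finset.set0D
    ?cards0//.
  by apply/setP => j; rewrite !inE eqxx.
by move: abm; rewrite (cardsD1 i) inE abi add1n ltnS.
Qed.

End UniformAdversary.

(** * Transfer of susceptibility between capabilities *)

Lemma stationary_mass_compl (R : realType) (T : finType) (P : T -> T -> R)
    (mu : {ffun T -> R}) (a : T) :
  stationary P mu -> 1 - mu a = \sum_(b | b != a) mu b.
Proof. by move=> [_ mu1 _]; rewrite -mu1 (bigD1 a)//= addrAC subrr add0r. Qed.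

(** The mass off [all_y] under [k2] is at most a constant times that under [k1], so it vanishes in
    the limit as well. *)
Lemma susceptible_UR (R : realType) n (G : simple_graph n) (alpha : R) k1 k2 :
  (0 < k1 < n)%N -> (0 < k2 < n)%N ->
  susceptible G alpha (UR R n k1) -> susceptible G alpha (UR R n k2).
Proof.
move=> h1 h2.
have n0 : (0 < n)%N by case/andP: h1 => _; exact: leq_ltn_trans.
have le_n k : (0 < k < n)%N -> (k <= n)%N by case/andP => _ /ltnW.
pose P k beta := transition G alpha (UR R n k) beta.
pose mu k beta := stationary_distribution (P k beta).
have muP k beta : (0 < k < n)%N -> stationary (P k beta) (mu k beta).
  move=> hk; apply: stationary_distributionP (all_y n) _ _.
    by move=> ? ?; exact: transition_ge0.
  by move=> ?; rewrite transition_sum1// le_n.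
(* [2 ^ n] compares single steps, the power [n] comes from taking [n] steps to reach any profile,
   and the outer exponent from elimination. Nothing depends on [beta]. *)
pose K : R := ((2 ^ n)%:R ^+ n) ^+ (2 * 3 ^ #|profile n|).
have mu_dom beta a : mu k2 beta a <= K * mu k1 beta a.
  have [p1 p2] := (muP _ beta h1, muP _ beta h2).
  apply: (stationary_dominated (P := P k2 beta) (Q := P k1 beta)) => //.
  - by rewrite ler1n expn_gt0.
  - by move=> ? ?; exact: transition_ge0.
  - by move=> ? ?; exact: transition_ge0.
  - by move=> ?; rewrite transition_sum1// le_n.
  - by move=> ?; rewrite transition_sum1// le_n.
  - move=> b c; apply: transition_pow_gt0 => //.
    by rewrite (leq_trans (max_card _))// card_ord.
  - move=> b c; apply: transition_pow_gt0 => //.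
    by rewrite (leq_trans (max_card _))// card_ord.
  - by apply: transition_dominated => //; exact: le_n.
  - by apply: transition_dominated => //; exact: le_n.
have near1 beta : 1 - K * (1 - mu k1 beta (all_y n)) <= mu k2 beta (all_y n).
  rewrite lerBlDr addrC -lerBlDr.
  rewrite (stationary_mass_compl _ (muP k1 beta h1)).
  rewrite (stationary_mass_compl _ (muP k2 beta h2)).
  by rewrite mulr_sumr ler_sum.
have le1 beta : mu k2 beta (all_y n) <= 1.
  rewrite -subr_ge0 (stationary_mass_compl _ (muP k2 beta h2)).
  rewrite sumr_ge0// => b _.
  by case: (muP k2 beta h2).
rewrite /susceptible /strictly_stochastically_stable => cvg1.
apply: (@squeeze_cvgr _ _ _ _
  (fun beta => 1 - K * (1 - mu k1 beta (all_y n))) (fun=> 1)).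
- by apply: nearW => beta; rewrite near1 le1.
- have : (1 - K * (1 - mu k1 beta (all_y n)) @[beta --> +oo] -->
      1 - K * (1 - 1))%classic.
    apply: cvgB; first exact: cvg_cst.
    by apply: cvgMr; apply: cvgB; [exact: cvg_cst|exact: cvg1].
  by rewrite subrr mulr0 subr0.
- exact: cvg_cst.
Qed.

Theorem theorem4 (R : realType) (n : nat) (G : simple_graph n) (k : nat)
    (hk : (2 <= k <= n.-1)%N) :
  alpha_sus G (UR R n k) = alpha_sus G (UR R n 1).
Proof.
(* The bounds force [1 < n], so both [k] and 1 lie strictly between 0 and [n]. *)
have [k2 kn] := andP hk; have n1 : (1 < n)%N.
  exact: leq_trans (leq_trans k2 kn) (leq_pred n).
have hk1 : (0 < k < n)%N.
  by rewrite (ltnW k2) (leq_ltn_trans kn)// ltn_predL ltnW.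
rewrite /alpha_sus; congr (ereal_sup (image _ _)).
(* The two inclusions are the same lemma with the capabilities exchanged. *)
by apply/seteqP; split => alpha; exact: susceptible_UR.
Qed.
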